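(* There is a universal constant $C'>0$ such that the following holds. For every $\gamma<1/2$, $p\in[0,1]$ and $n\ge 1$, let \[ \Delta=C'\cdot\left(\frac{\sqrt{p(1-p)}}{n}+\frac{\gamma\sqrt{p(1-p)}}{\sqrt n}+\frac{\gamma}{n}\right). \] For any $p'\in[p-\Delta,p+\Delta]\cap[0,1]$, with $G\sim G(n,p)$ and $G'\sim G(n,p')$, there exists a $\gamma$-oblivious adversary $\mathcal{A}$ such that no algorithm can distinguish between $\mathcal{A}(G)$ and $\mathcal{A}(G')$ with probability more than $0.65$.
   Context: $G(n,p)$ is the distribution over undirected graphs on node set $[n]$ in which each edge is present independently with probability $p$. A $\gamma$-oblivious adversary knows the edge parameter but not the realization of the graph; it chooses (possibly randomly) a set $B\subseteq[n]$ with $|B|\le\gamma n$ and a distribution over the status of all edges with at least one endpoint in $B$, and replaces those edges accordingly, independently of the realized graph. ''Distinguish with probability more than $0.65$'' means a test, given the corrupted graph, outputs which of the two underlying models generated it, being correct with probability more than $0.65$. *)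

(* Defs.v *)
From HB Require Import structures.
From mathcomp Require Import all_boot all_order all_algebra.
From mathcomp Require Import reals.

Set Implicit Arguments.
Unset Strict Implicit.
Unset Printing Implicit Defensive.

Import Order.TTheory GRing.Theory Num.Theory.
Local Open Scope ring_scope.

Section Distributions.
Variable R : realType.

Record dist (T : finType) := Dist {
  pmf :> T -> R;
  pmf_ge0 : forall x, 0 <= pmf x;
  pmf_sum1 : \sum_x pmf x = 1
}.

Lemma dret_ge0 (T : finType) (a x : T) : 0 <= (x == a)%:R :> R.
Proof. exact: ler0n. Qed.

Lemma dret_sum1 (T : finType) (a : T) : \sum_x (x == a)%:R = 1 :> R.
Proof. by rewrite (bigD1 a) //= eqxx big1 ?addr0 // => x /negbTE ->. Qed.

Definition dret (T : finType) (a : T) : dist T :=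
  Dist (dret_ge0 a) (dret_sum1 a).

Lemma dbind_ge0 (T U : finType) (d : dist T) (f : T -> dist U) y :
  0 <= \sum_x d x * f x y.
Proof. by apply: sumr_ge0 => x _; rewrite mulr_ge0 ?pmf_ge0. Qed.

Lemma dbind_sum1 (T U : finType) (d : dist T) (f : T -> dist U) :
  \sum_y \sum_x d x * f x y = 1.
Proof.
rewrite exchange_big /= -(pmf_sum1 d); apply: eq_bigr => x _.
by rewrite -mulr_sumr pmf_sum1 mulr1.
Qed.

Definition dbind (T U : finType) (d : dist T) (f : T -> dist U) : dist U :=
  Dist (dbind_ge0 d f) (dbind_sum1 d f).

End Distributions.

Notation edge n := {e : {set 'I_n} | #|e| == 2%N}.

(* A simple undirected graph on 'I_n is identified with its edge set. *)
Notation graph n := {set edge n}.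

Section RandomGraphs.
Variables (R : realType) (n : nat).

Definition gnp_pmf (p : R) (G : graph n) : R :=
  \prod_(e : edge n) (if e \in G then p else 1 - p).

Lemma gnp_pmf_ge0 (p : R) : 0 <= p <= 1 -> forall G, 0 <= gnp_pmf p G.
Proof.
by case/andP=> p0 p1 G; apply: prodr_ge0 => e _; case: ifP; rewrite ?subr_ge0.
Qed.

Lemma gnp_pmf_sum1 (p : R) : \sum_G gnp_pmf p G = 1.
Proof.
transitivity (\prod_(e : edge n) (p + (1 - p))).
  by rewrite bigA_distr; apply: eq_bigr => G _.
by rewrite big1 // => e _; rewrite addrC subrK.
Qed.

Definition gnp (p : R) (hp : 0 <= p <= 1) : dist R (graph n) :=
  Dist (gnp_pmf_ge0 hp) (gnp_pmf_sum1 p).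

Definition touches (B : {set 'I_n}) (e : edge n) : bool :=
  [exists v in B, v \in val e].

(* Edges touching B take their status from H, all others from G. *)
Definition rewire (B : {set 'I_n}) (H G : graph n) : graph n :=
  [set e | if touches B e then e \in H else e \in G].

(* A distribution over the statuses of the edges touching B is given as a     *)
(* distribution over graphs H, of which only the edges touching B are used.   *)
Record oblivious_strategy (gamma : R) := ObliviousStrategy {
  bad_set : dist R {set 'I_n};
  bad_set_card : forall B, bad_set B != 0 -> #|B|%:R <= gamma * n%:R;
  bad_edges : {set 'I_n} -> dist R (graph n)
}.

(* The adversary knows the edge parameter, hence may choose its strategy as a *)
(* function of it; it does not see the realized graph.                        *)
Definition oblivious_adversary (gamma : R) : Type :=
  R -> oblivious_strategy gamma.

(* The law of the corrupted graph A(G), for G drawn from G(n,p). *)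
Definition corrupted (gamma : R) (A : oblivious_adversary gamma)
    (p : R) (hp : 0 <= p <= 1) : dist R (graph n) :=
  dbind (gnp hp) (fun G =>
  dbind (bad_set (A p)) (fun B =>
  dbind (bad_edges (A p) B) (fun H =>
  dret R (rewire B H G)))).

(* A (randomized) algorithm outputs true for the first model and false for    *)
(* the second one.                                                            *)
Definition algorithm : Type := graph n -> dist R bool.

(* The probability that the algorithm is correct when the model generating    *)
(* its input is one of P and Q with probability 1/2 each.                     *)
Definition success_prob (T : algorithm) (P Q : dist R (graph n)) : R :=
  (dbind P T true + dbind Q T false) / 2.

End RandomGraphs.

Definition Delta (R : realType) (C' : R) (n : nat) (gamma p : R) : R :=
  C' * (Num.sqrt (p * (1 - p)) / n%:R
        + gamma * Num.sqrt (p * (1 - p)) / Num.sqrt n%:R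
        + gamma / n%:R).

(* Main.v *)
(** Assign each edge to one of its endpoints, its owner. Under G(n,p) the status
    vectors P_v of the edges owned by v are independent over v. Suppose that
    the total variation distance between P_v and its analogue Q_v for p' is at
    most eps for every v. Then M_v := max(P_v, Q_v) / sum max(P_v, Q_v)
    satisfies M_v >= (1 - eps) P_v and M_v >= (1 - eps) Q_v, so it is an
    eps-contamination of both. An adversary that puts each vertex in B
    independently with probability eps and draws the edges owned by B from the
    contaminating laws produces exactly the product of the M_v from either model.
    With eps = gamma / 10, Markov's inequality gives |B| > gamma n with
    probability at most 1/10; in that case B is replaced by the empty set.

    Delta is a sum of three terms, and |p' - p| is at most three times one of
    them. For the first one, G(n,p) and G(n,p') are already close by a
    chi-square bound and the adversary does nothing; for the second and third,
    the distance of P_v and Q_v is bounded by chi-square and by a union bound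
    over the at most n edges owned by v. *)
Require Import Defs.
From mathcomp Require Import all_boot all_order all_algebra.
From mathcomp Require Import reals.
From mathcomp Require Import ring lra.

Set Implicit Arguments.
Unset Strict Implicit.
Unset Printing Implicit Defensive.

Import Order.TTheory GRing.Theory Num.Theory.
Local Open Scope ring_scope.

(** * Product weights on subsets and their sums *)

Lemma sum_subset_prod (R : comRingType) (E : finType) (A : {set E})
    (f g : E -> R) :
  \sum_(K : {set E} | K \subset A)
      \prod_(e in A) (if e \in K then f e else g e) =
  \prod_(e in A) (f e + g e).
Proof.
pose f' e := if e \in A then f e else 0.
pose g' e := if e \in A then g e else 1.
transitivity (\prod_e (f' e + g' e)); last first.
  rewrite [RHS]big_mkcond; apply: eq_bigr => e _; rewrite /f' /g'.
  by case: ifP; rewrite ?add0r.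
rewrite bigA_distr [LHS]big_mkcond; apply: eq_bigr => K _; case: ifP => KA.
  rewrite [LHS]big_mkcond; apply: eq_bigr => e _; rewrite /f' /g'.
  by case: ifP => // eA; case: ifP => // /(subsetP KA); rewrite eA.
have /subsetPn[e eK eA] := negbT KA.
by rewrite (bigD1 e) //= eK /f' (negbTE eA) mul0r.
Qed.

Definition determined_on (R : Type) (E : finType) (A : {set E})
  (F : {set E} -> R) := forall K, F (K :&: A) = F K.

(** Independence over the fibers of [o]: a subset of [E] amounts to one subset of each fiber, with
    [glue] and [cut] as inverse bijections, and distributivity does the rest. *)
Lemma sum_prod_fibers (R : comRingType) (E I : finType) (o : E -> I)
    (F : I -> {set E} -> R) :
  (forall i, determined_on (o @^-1: [set i]) (F i)) ->
  \sum_K \prod_i F i K =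
  \prod_i \sum_(K : {set E} | K \subset o @^-1: [set i]) F i K.
Proof.
move=> FD; rewrite bigA_distr_big_dep.
pose glue (f : {ffun I -> {set E}}) := [set e | e \in f (o e)].
pose cut (K : {set E}) := [ffun i => K :&: o @^-1: [set i]].
rewrite (reindex_onto glue cut) /=; last first.
  by move=> K _; apply/setP=> e; rewrite !inE ffunE !inE eqxx andbT.
apply: eq_big => [f | f /eqP fK].
  apply/eqP/familyP => [<- i | fam].
    by rewrite ffunE unfold_in /= subsetIr.
  apply/ffunP=> i; rewrite ffunE; apply/setP=> e; rewrite !inE.
  have := fam i; rewrite unfold_in => /subsetP /(_ e); rewrite !inE.
  case: (o e =P i) => [-> | _]; rewrite ?andbT // andbF.
  by case: (e \in f i) => // /(_ isT).
by apply: eq_bigr => i _; rewrite -[in RHS]fK ffunE FD.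
Qed.

Definition bern (R : ringType) (E : finType) (p : R) (A K : {set E}) : R :=
  \prod_(e in A) (if e \in K then p else 1 - p).

Lemma bern_determined (R : ringType) (E : finType) (p : R) (A : {set E}) :
  determined_on A (bern p A).
Proof. by move=> K; apply: eq_bigr => e eA; rewrite inE eA andbT. Qed.

Lemma sum_bern (R : comRingType) (E : finType) (p : R) (A : {set E}) :
  \sum_(K : {set E} | K \subset A) bern p A K = 1.
Proof. by rewrite sum_subset_prod big1 // => e _; rewrite addrC subrK. Qed.

Lemma bern_ge0 (R : realDomainType) (E : finType) (p : R) (A K : {set E}) :
  0 <= p <= 1 -> 0 <= bern p A K.
Proof.
by case/andP=> p0 p1; apply: prodr_ge0 => e _; case: ifP; rewrite ?subr_ge0.
Qed.

(** * Bounds on the total variation distance of Bernoulli products *)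

Lemma bernoulli_ineq_sub (R : realDomainType) (x : R) (m : nat) :
  0 <= x <= 1 -> 1 - m%:R * x <= (1 - x) ^+ m.
Proof.
case/andP=> x0 x1; elim: m => [|m IH]; first by rewrite mul0r subr0 expr0.
rewrite exprS; apply: le_trans (_ : (1 - x) * (1 - m%:R * x) <= _); last first.
  by rewrite ler_wpM2l // subr_ge0.
rewrite -natr1; have : 0 <= m%:R * x ^+ 2 by rewrite mulr_ge0 ?sqr_ge0 ?ler0n.
by rewrite expr2; nra.
Qed.

(** Since [(1 + x)^m (1 - x)^m <= 1], Bernoulli's inequality gives [(1 + x)^m <= 1 / (1 - m x)], and
    [1 / (1 - t) <= 1 + 2 t] for [0 <= t <= 1/2]. *)
Lemma exprD1_le (R : realFieldType) (x : R) (m : nat) :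
  0 <= x -> m%:R * x <= 1 / 2 -> (1 + x) ^+ m <= 1 + 2 * (m%:R * x).
Proof.
case: m => [|m] x0 hx; first by rewrite mul0r mulr0 addr0 expr0.
have mx : x <= m.+1%:R * x by rewrite ler_peMl // ler1n.
have h1 : 1 - m.+1%:R * x <= (1 - x) ^+ m.+1.
  by apply: bernoulli_ineq_sub; rewrite x0 /=; lra.
have h2 : (1 + x) ^+ m.+1 * (1 - x) ^+ m.+1 <= 1.
  by rewrite -exprMn; apply: exprn_ile1; nra.
have h3 : 0 <= (1 + x) ^+ m.+1 by apply: exprn_ge0; lra.
move: h1 h2 h3 mx hx; set y := _ ^+ _; set z := _ ^+ _; set t := _ * x.
by move=> *; nra.
Qed.

(* [sum max(P, Q) = 1 + TV(P, Q)] for probability mass functions; since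
   [max(P, Q) <= (1 + a) P + (Q - P)^2 / (4 a P)], it is at most
   [1 + a + chi2 / (4 a)], and the chi-square divergence tensorizes. *)
Lemma sum_max_bern_chi2 (R : realFieldType) (E : finType) (A : {set E})
    (p q a : R) :
  0 < p < 1 -> 0 < a ->
  #|A|%:R * ((q - p) ^+ 2 / (p * (1 - p))) <= 1 / 2 ->
  \sum_(K : {set E} | K \subset A) Num.max (bern p A K) (bern q A K) <=
  1 + a + #|A|%:R * ((q - p) ^+ 2 / (p * (1 - p))) / (2 * a).
Proof.
case/andP=> p0 p1 a0; set x := _ / (p * _) => hx.
have q1 : 0 < 1 - p by rewrite subr_gt0.
have x0 : 0 <= x by rewrite divr_ge0 ?sqr_ge0 // mulr_ge0 ?ltW.
have P0 K : 0 < bern p A K by apply: prodr_gt0 => e _; case: ifP.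
pose X K := bern q A K ^+ 2 / bern p A K.
have maxle K : Num.max (bern p A K) (bern q A K) <=
    (1 + a) * bern p A K + (X K - 2 * bern q A K + bern p A K) / (4 * a).
  rewrite /X; move: (P0 K); set P := bern p A K; set Q := bern q A K => P1.
  have -> : Q ^+ 2 / P - 2 * Q + P = (Q - P) ^+ 2 / P.
    by field; rewrite gt_eqF.
  have sq0 : 0 <= (Q - P) ^+ 2 / P / (4 * a).
    by rewrite !divr_ge0 ?sqr_ge0 ?ltW //; lra.
  rewrite ge_max; apply/andP; split; first by nra.
  rewrite -subr_ge0.
  (* The bound by [Q] is an instance of AM-GM: the difference is a perfect square over a positive
     number. *)
  have -> : (1 + a) * P + (Q - P) ^+ 2 / P / (4 * a) - Q =
      (2 * a * P - (Q - P)) ^+ 2 / (4 * a * P).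
    by field; rewrite !gt_eqF.
  by rewrite divr_ge0 ?sqr_ge0 // !mulr_ge0 ?ltW.
have sumX : \sum_(K : {set E} | K \subset A) X K = (1 + x) ^+ #|A|.
  pose f b := (if b then q else 1 - q) ^+ 2 / (if b then p else 1 - p).
  transitivity (\sum_(K : {set E} | K \subset A)
      \prod_(e in A) (if e \in K then f true else f false)).
    apply: eq_bigr => K _; rewrite /X /bern -prodrXl -prodf_div.
    by apply: eq_bigr => e _; rewrite /f; case: ifP.
  (* Each coordinate contributes [q^2 / p + (1 - q)^2 / (1 - p) = 1 + x]. *)
  rewrite sum_subset_prod big_const iter_mulr_1; congr (_ ^+ _).
  by rewrite /f /x; field; rewrite !gt_eqF.
apply: le_trans (ler_sum _ (fun K _ => maxle K)) _.
rewrite big_split /= -mulr_sumr sum_bern -mulr_suml big_split /= sumrB sumX.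
rewrite -mulr_sumr !sum_bern !mulr1 lerD2l.
apply: (@le_trans _ _ (2 * (#|A|%:R * x) / (4 * a))).
  rewrite ler_pM2r ?invr_gt0 ?mulr_gt0 //.
  by have := exprD1_le x0 hx; lra.
by rewrite le_eqVlt; apply/orP; left; apply/eqP; field; rewrite gt_eqF.
Qed.

Lemma prod_min_le (R : realDomainType) (E : finType) (A : {set E})
    (f g : E -> R) :
  (forall e, 0 <= f e) -> (forall e, 0 <= g e) ->
  \prod_(e in A) Num.min (f e) (g e) <=
  Num.min (\prod_(e in A) f e) (\prod_(e in A) g e).
Proof.
move=> f0 g0; rewrite le_min; apply/andP; split; apply: ler_prod => e _;
  by rewrite le_min f0 g0 ge_min lexx ?orbT.
Qed.

(* Union bound, in the form [min(P, Q) >= prod_e min(P_e, Q_e)]. *)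
Lemma sum_max_bern_union (R : realFieldType) (E : finType) (A : {set E})
    (p q : R) :
  0 <= p <= 1 -> 0 <= q <= 1 ->
  \sum_(K : {set E} | K \subset A) Num.max (bern p A K) (bern q A K) <=
  1 + #|A|%:R * `|q - p|.
Proof.
move=> hp hq; have [p0 p1] := andP hp; have [q0 q1] := andP hq.
pose f r b : R := if b then r else 1 - r.
have f0 r b : 0 <= r <= 1 -> 0 <= f r b.
  by case/andP=> r0 r1; rewrite /f; case: b; lra.
have maxE K : Num.max (bern p A K) (bern q A K) <= bern p A K + bern q A K -
    \prod_(e in A) (if e \in K then Num.min (f p true) (f q true)
                    else Num.min (f p false) (f q false)).
  rewrite -(addr_max_min (bern p A K)) -addrA lerDl subr_ge0.
  apply: le_trans (_ : Num.min (\prod_(e in A) f p (e \in K))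
                               (\prod_(e in A) f q (e \in K)) <= _) => //.
  apply: le_trans (prod_min_le _ _ _) => [||]; try by move=> e; apply: f0.
  rewrite le_eqVlt; apply/orP; left; apply/eqP.
  by apply: eq_bigr => e _; case: ifP.
apply: le_trans (ler_sum _ (fun K _ => maxE K)) _.
rewrite sumrB big_split /= !sum_bern sum_subset_prod big_const iter_mulr_1.
(* The overlap of two Bernoulli laws on a single edge is one minus their total variation
   distance. *)
have -> : Num.min (f p true) (f q true) + Num.min (f p false) (f q false) =
    1 - `|q - p|.
  rewrite /f; case: (leP p q) => pq.
    by rewrite ger0_norm ?subr_ge0 // min_r ?lerD2l ?lerN2 //; lra.
  by rewrite ltr0_norm ?subr_lt0 // min_l ?lerD2l ?lerN2 ?ltW //; lra.
have : 1 - #|A|%:R * `|q - p| <= (1 - `|q - p|) ^+ #|A|.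
  apply: bernoulli_ineq_sub; rewrite normr_ge0 /= ler_norml; lra.
by lra.
Qed.

(** * Owners of edges *)

Lemma edge_inhabited n (e : edge n) : exists v, v \in val e.
Proof. by apply/card_gt0P; rewrite (eqP (valP e)). Qed.

(** Any choice of endpoint would do: what matters is that the sets [owned v] partition the edges and
    that an edge owned by a vertex of [B] touches [B]. *)
Definition owner n (e : edge n) : 'I_n := xchoose (edge_inhabited e).

Lemma owner_in n (e : edge n) : owner e \in val e.
Proof. exact: xchooseP. Qed.

Definition owned n (v : 'I_n) : {set edge n} := @owner n @^-1: [set v].

Lemma touches_owned n (B : {set 'I_n}) (v : 'I_n) (e : edge n) :
  v \in B -> e \in owned v -> touches B e.
Proof.
rewrite !inE => vB /eqP ov; apply/existsP; exists v; rewrite vB /=.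
by rewrite -ov owner_in.
Qed.

Lemma card_owned n (v : 'I_n) : (#|owned v| <= n)%N.
Proof.
(* An edge owned by [v] is determined by its other endpoint. The default [v] is never reached on
   such edges. *)
pose other (e : edge n) := odflt v [pick w in val e :\ v].
have otherP e : e \in owned v -> val e = [set v; other e].
  rewrite !inE => /eqP ov; have vE : v \in val e by rewrite -ov owner_in.
  have := valP e; rewrite (cardsD1 v) vE eqSS => /cards1P[w Ew].
  rewrite /other; case: pickP => [u | /(_ w)]; last by rewrite Ew inE eqxx.
  by rewrite Ew inE => /eqP -> /=; rewrite -(setD1K vE) Ew.
rewrite -(card_in_imset (f := other)).
  by rewrite -[leqRHS]card_ord max_card.
by move=> e1 e2 /otherP E1 /otherP E2 E; apply/val_inj; rewrite E1 E2 E.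
Qed.

Lemma card_edges n : (#|[set: edge n]| <= n * n)%N.
Proof.
rewrite cardsT -sum1_card (partition_big (@owner n) xpredT) //=.
rewrite -[X in (_ <= X * _)%N]card_ord -sum_nat_const; apply: leq_sum => v _.
apply: leq_trans (card_owned v); rewrite sum1_card.
by apply: subset_leq_card; apply/subsetP => e; rewrite !inE.
Qed.

(** * Factorization of G(n,p), success of tests, and laws of corrupted graphs *)

Lemma gnp_pmf_bernT (R : realType) n (p : R) (G : graph n) :
  gnp_pmf p G = bern p setT G.
Proof. by rewrite /bern big_mkcond; apply: eq_bigr => e _; rewrite inE. Qed.

Lemma gnp_pmf_owned (R : realType) n (p : R) (G : graph n) :
  gnp_pmf p G = \prod_v bern p (owned v) G.
Proof.
rewrite /gnp_pmf (partition_big (@owner n) xpredT) //=.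
by apply: eq_bigr => v _; apply: eq_bigl => e; rewrite !inE.
Qed.

Lemma sum_prod_owned (R : realType) n (F : 'I_n -> graph n -> R) :
  (forall v, determined_on (owned v) (F v)) ->
  (forall v, \sum_(K : graph n | K \subset owned v) F v K = 1) ->
  \sum_K \prod_v F v K = 1.
Proof.
by move=> FD F1; rewrite (sum_prod_fibers FD) big1 // => v _; exact: F1.
Qed.

(** The two answers of [T] on a graph have total probability 1, so the common majorant [M] is
    counted only once, and each excess [D], [D'] at most once. *)
Lemma success_prob_le (R : realType) n (T : algorithm R n)
    (P Q : dist R (graph n)) (M D D' : graph n -> R) :
  (forall K, P K <= M K + D K) -> (forall K, Q K <= M K + D' K) ->
  (forall K, 0 <= D K) -> (forall K, 0 <= D' K) ->
  success_prob T P Q <= (\sum_K M K + \sum_K D K + \sum_K D' K) / 2.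
Proof.
move=> PM QM D0 D'0; rewrite /success_prob /= ler_pM2r ?invr_gt0 //.
rewrite -!big_split /=; apply: ler_sum => K _.
have Tt := pmf_ge0 (T K) true; have Tf := pmf_ge0 (T K) false.
have T1 : T K true + T K false = 1 by rewrite -(pmf_sum1 (T K)) big_bool.
have := PM K; have := QM K; have := D0 K; have := D'0 K.
by move: Tt Tf T1; set t := T K true; set u := T K false => *; nra.
Qed.

(* Exchanging the untouched edges of [H] and [G] is an involution; when it
   preserves the joint law, [rewire B H G] has the law of [H]. *)
Lemma sum_rewire (R : realType) n (B : {set 'I_n}) (X Y : graph n -> R)
    (K : graph n) :
  (forall H G, X (rewire B H G) * Y (rewire B G H) = X H * Y G) ->
  \sum_G Y G = 1 ->
  \sum_G Y G * \sum_H X H * (K == rewire B H G)%:R = X K.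
Proof.
move=> swap Y1; pose sw (u : graph n * graph n) :=
  (rewire B u.1 u.2, rewire B u.2 u.1).
have swK : involutive sw.
  by case=> H G; rewrite /sw /=; congr (_, _); apply/setP=> e;
    rewrite !inE; case: (touches B e).
transitivity (\sum_u X u.1 * Y u.2 * (K == (sw u).1)%:R).
  under eq_bigr do rewrite mulr_sumr.
  rewrite exchange_big pair_bigA /=; apply: eq_bigr => -[H G] _ /=.
  by rewrite mulrA (mulrC (Y G)).
rewrite (reindex_inj (inv_inj swK)) /=.
under eq_bigr do rewrite swap [rewire _ (rewire _ _ _) _](congr1 fst (swK _)).
rewrite -(pair_bigA _ (fun H G => X H * Y G * (K == H)%:R)) /=.
rewrite (bigD1 K) //= [X in _ + X]big1 ?addr0.
  by under eq_bigr do rewrite eqxx mulr1; rewrite -mulr_sumr Y1 mulr1.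
move=> H /negbTE HK; apply: big1 => G _.
by rewrite eq_sym HK mulr0.
Qed.

(** The strategies below take [bad_edges] to be the law of the whole corrupted graph. Its untouched
    edges are discarded by [rewire], but the edges of [G] that replace them have the same law. *)
Lemma corruptedE (R : realType) n (gamma : R) (A : oblivious_adversary n gamma)
    (p : R) (hp : 0 <= p <= 1) (K : graph n) :
  (forall B H G, bad_edges (A p) B (rewire B H G) * gnp_pmf p (rewire B G H) =
                 bad_edges (A p) B H * gnp_pmf p G) ->
  corrupted A hp K = \sum_B bad_set (A p) B * bad_edges (A p) B K.
Proof.
move=> swap; rewrite /corrupted /=.
under eq_bigr do rewrite mulr_sumr.
rewrite exchange_big; apply: eq_bigr => B _ /=.
under eq_bigr do rewrite mulrCA.
rewrite -mulr_sumr; congr (_ * _).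
by apply: (sum_rewire _ (swap B)); exact: gnp_pmf_sum1.
Qed.

Lemma bern_swap (R : realType) n (p : R) (A : {set edge n}) B (H G : graph n) :
  bern p A (rewire B H G) * bern p A (rewire B G H) = bern p A H * bern p A G.
Proof.
rewrite -!big_split; apply: eq_bigr => e _ /=; rewrite !inE.
by case: (touches B e) => //; rewrite mulrC.
Qed.

Lemma empty_set_card (R : realType) n (gamma : R) : 0 <= gamma ->
  forall B : {set 'I_n}, dret R set0 B != 0 -> #|B|%:R <= gamma * n%:R.
Proof.
move=> g0 B /=; case: (B =P set0) => [-> _ | _]; last by rewrite eqxx.
by rewrite cards0 mulr_ge0 // ler0n.
Qed.

(** With an empty bad set every edge comes from [G]; choosing [gnp] for [bad_edges] makes the
    exchange hypothesis of [corruptedE] hold. *)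
Definition idle_strategy (R : realType) n (gamma : R) (g0 : 0 <= gamma)
    (p : R) (hp : 0 <= p <= 1) : oblivious_strategy n gamma :=
  ObliviousStrategy (empty_set_card g0) (fun=> gnp n hp).

Lemma corrupted_idle (R : realType) n (gamma : R) (g0 : 0 <= gamma)
    (A : oblivious_adversary n gamma) (p : R) (hp : 0 <= p <= 1) K :
  A p = idle_strategy n g0 hp -> corrupted A hp K = gnp_pmf p K.
Proof.
move=> Ap; rewrite corruptedE Ap => [|B H G].
  by rewrite -mulr_suml (pmf_sum1 (dret R set0)) mul1r.
by rewrite /= !gnp_pmf_bernT bern_swap.
Qed.

(** * The random bad set and its truncation *)

Lemma random_subset_ge0 (R : realType) (I : finType) (eps : R) :
  0 <= eps <= 1 -> forall B : {set I}, 0 <= bern eps setT B.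
Proof. by move=> heps B; apply: bern_ge0. Qed.

Lemma random_subset_sum1 (R : realType) (I : finType) (eps : R) :
  \sum_(B : {set I}) bern eps setT B = 1.
Proof.
rewrite -[RHS](sum_bern eps [set: I]).
by apply: eq_bigl => B; rewrite subsetT.
Qed.

Definition random_subset (R : realType) (I : finType) (eps : R)
    (heps : 0 <= eps <= 1) : dist R {set I} :=
  Dist (random_subset_ge0 heps) (random_subset_sum1 I eps).

Lemma sum_bern_mem (R : realType) (I : finType) (eps : R) (i : I) :
  \sum_(B : {set I} | i \in B) bern eps setT B = eps.
Proof.
(* Setting the weight of leaving out [i] to zero removes the sets that miss [i]; every other factor
   is still 1. *)
pose g j : R := if j == i then 0 else 1 - eps.
transitivity (\prod_j (eps + g j)); last first.
  rewrite (bigD1 i) //= /g eqxx addr0 big1 ?mulr1 // => j /negbTE ->.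
  by rewrite addrC subrK.
rewrite bigA_distr [LHS]big_mkcond; apply: eq_bigr => B _; case: ifP => iB.
  rewrite /bern [LHS]big_mkcond; apply: eq_bigr => j _; rewrite inE /g.
  by case: eqP => [->|//]; rewrite iB.
by rewrite (bigD1 i) //= iB /g eqxx mul0r.
Qed.

Lemma random_subset_markov (R : realType) (I : finType) (eps t : R) :
  0 <= eps <= 1 ->
  t * (\sum_(B : {set I} | ~~ (#|B|%:R <= t)) bern eps setT B) <= #|I|%:R * eps.
Proof.
move=> heps.
apply: (@le_trans _ _ (\sum_(B : {set I}) #|B|%:R * bern eps setT B)).
  rewrite mulr_sumr [leLHS]big_mkcond; apply: ler_sum => B _.
  have B0 : 0 <= bern eps [set: I] B by apply: bern_ge0.
  case: ifP => [|_]; last by rewrite mulr_ge0 ?ler0n.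
  by rewrite -ltNge => /ltW; exact: ler_wpM2r.
rewrite le_eqVlt; apply/orP; left; apply/eqP.
transitivity (\sum_(B : {set I}) \sum_(i in B) bern eps setT B).
  by apply: eq_bigr => B _; rewrite sumr_const mulr_natl.
rewrite (exchange_big_dep xpredT) //= (eq_bigr (fun=> eps)) => [|i _].
  by rewrite sumr_const mulr_natl.
exact: sum_bern_mem.
Qed.

Definition truncate_set (R : realType) n (t : R) (B : {set 'I_n}) : {set 'I_n} :=
  if #|B|%:R <= t then B else set0.

Definition truncated_subset (R : realType) n (t eps : R)
    (heps : 0 <= eps <= 1) : dist R {set 'I_n} :=
  dbind (random_subset 'I_n heps) (fun B => dret R (truncate_set t B)).

Lemma truncated_subset_card (R : realType) n (t eps : R)
    (heps : 0 <= eps <= 1) (t0 : 0 <= t) (B : {set 'I_n}) :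
  truncated_subset n t heps B != 0 -> #|B|%:R <= t.
Proof.
apply: contraR => Bt; rewrite /= big1 // => B' _.
suff /negbTE -> : B != truncate_set t B' by rewrite mulr0.
apply: contraNneq Bt => ->; rewrite /truncate_set.
by case: ifP => //; rewrite cards0.
Qed.

Lemma sum_truncated_subset (R : realType) n (t eps : R)
    (heps : 0 <= eps <= 1) (f : {set 'I_n} -> R) :
  \sum_B truncated_subset n t heps B * f B =
  \sum_B bern eps setT B * f (truncate_set t B).
Proof.
under eq_bigr do rewrite /= mulr_suml.
rewrite exchange_big; apply: eq_bigr => B _ /=.
rewrite (bigD1 (truncate_set t B)) //= eqxx mulr1 big1 ?addr0 //.
by move=> C /negbTE ->; rewrite mulr0 mul0r.
Qed.

(** * Contamination of the laws of owned edges *)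

Definition bad_law (R : realType) n (eps p : R) (M : 'I_n -> graph n -> R)
    (v : 'I_n) (H : graph n) : R :=
  (M v H - (1 - eps) * bern p (owned v) H) / eps.

(** An edge owned outside [B] may still touch [B]; the adversary then redraws it from its original
    Bernoulli law. *)
Definition huber_law (R : realType) n (eps p : R) (M : 'I_n -> graph n -> R)
    (B : {set 'I_n}) (H : graph n) : R :=
  \prod_v (if v \in B then bad_law eps p M v H else bern p (owned v) H).

(* [(M v - (1 - eps) P_v) / eps] is a probability law on the edges owned by [v]. *)
Record contaminates (R : realType) n (eps p : R) (M : 'I_n -> graph n -> R) :=
  Contaminates {
  cont_eps : 0 < eps <= 1;
  cont_p : 0 <= p <= 1;
  cont_det : forall v, determined_on (owned v) (M v);
  cont_sum1 : forall v, \sum_(K : graph n | K \subset owned v) M v K = 1;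
  cont_ge : forall v K, (1 - eps) * bern p (owned v) K <= M v K
}.

Lemma bad_law_determined (R : realType) n (eps p : R) M v :
  @contaminates R n eps p M -> determined_on (owned v) (bad_law eps p M v).
Proof. by move=> cM K; rewrite /bad_law (cont_det cM) bern_determined. Qed.

Lemma huber_law_ge0 (R : realType) n (eps p : R) M B :
  @contaminates R n eps p M -> forall H, 0 <= huber_law eps p M B H.
Proof.
move=> cM H; apply: prodr_ge0 => v _; case: ifP => _; last first.
  exact/bern_ge0/(cont_p cM).
have /andP[e0 _] := cont_eps cM.
by rewrite /bad_law divr_ge0 ?(ltW e0) // subr_ge0 (cont_ge cM).
Qed.

Lemma huber_law_sum1 (R : realType) n (eps p : R) M B :
  @contaminates R n eps p M -> \sum_H huber_law eps p M B H = 1.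
Proof.
move=> cM; have /andP[e0 _] := cont_eps cM.
apply: (@sum_prod_owned _ _ (fun v H =>
  if v \in B then bad_law eps p M v H else bern p (owned v) H)) => v.
  by case: (v \in B); [exact: bad_law_determined | exact: bern_determined].
case: (v \in B); last exact: sum_bern.
rewrite -mulr_suml sumrB -mulr_sumr (cont_sum1 cM) sum_bern mulr1.
by field; rewrite gt_eqF.
Qed.

(** Factor by factor: if [v] is in [B], all edges owned by [v] touch [B] and stay in place;
    otherwise both factors are the same Bernoulli weight, which is symmetric under exchanging
    edges. *)
Lemma huber_law_swap (R : realType) n (eps p : R) M B (H G : graph n) :
  @contaminates R n eps p M ->
  huber_law eps p M B (rewire B H G) * gnp_pmf p (rewire B G H) =
  huber_law eps p M B H * gnp_pmf p G.
Proof.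
move=> cM; rewrite !gnp_pmf_owned -!big_split; apply: eq_bigr => v _ /=.
case: ifP => vB; last exact: bern_swap.
have rewire_owned H' G' : rewire B H' G' :&: owned v = H' :&: owned v.
  apply/setP=> e; rewrite in_setI [RHS]in_setI.
  case ev: (e \in owned v); rewrite ?andbF // !andbT inE.
  by rewrite (touches_owned vB ev).
congr (_ * _).
  rewrite -[LHS](bad_law_determined v cM) rewire_owned.
  exact: (bad_law_determined v cM).
by rewrite -[LHS]bern_determined rewire_owned bern_determined.
Qed.

(** Write each [M v] as [eps] times the bad law plus [1 - eps] times the Bernoulli law and expand
    the product: [B] records where the bad term is picked. *)
Lemma mixture_huber_law (R : realType) n (eps p : R) M (K : graph n) :
  @contaminates R n eps p M ->
  \sum_B bern eps setT B * huber_law eps p M B K = \prod_v M v K.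
Proof.
move=> cM; have /andP[e0 _] := cont_eps cM.
transitivity (\prod_v (eps * bad_law eps p M v K +
                       (1 - eps) * bern p (owned v) K)); last first.
  by apply: eq_bigr => v _; rewrite /bad_law; field; rewrite gt_eqF.
rewrite bigA_distr; apply: eq_bigr => B _; rewrite /bern /huber_law.
rewrite [X in X * _]big_mkcond -big_split; apply: eq_bigr => v _ /=.
by rewrite in_setT; case: ifP.
Qed.

Lemma lt0W_le1 (R : realType) (eps : R) : 0 < eps <= 1 -> 0 <= eps <= 1.
Proof. by case/andP=> /ltW -> ->. Qed.

Definition huber_strategy (R : realType) n (gamma eps p : R) M
    (g0 : 0 <= gamma) (cM : @contaminates R n eps p M) :
    oblivious_strategy n gamma :=
  ObliviousStrategy
    (fun B => @truncated_subset_card R n (gamma * n%:R) eps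
                (lt0W_le1 (cont_eps cM)) (mulr_ge0 g0 (ler0n _ n)) B)
    (fun B => Dist (huber_law_ge0 B cM) (huber_law_sum1 B cM)).

Definition overflow (R : realType) n (eps t : R) : R :=
  \sum_(B : {set 'I_n} | ~~ (#|B|%:R <= t)) bern eps setT B.

(** Without truncation the law is exactly the product of the [M v]. Truncation moves the mass of the
    oversized sets to [set0], which adds at most the last term. *)
Lemma corrupted_huber_le (R : realType) n (gamma eps p : R) M
    (g0 : 0 <= gamma) (cM : @contaminates R n eps p M)
    (A : oblivious_adversary n gamma) (hp : 0 <= p <= 1) K :
  A p = huber_strategy g0 cM ->
  corrupted A hp K <=
  \prod_v M v K + overflow n eps (gamma * n%:R) * huber_law eps p M set0 K.
Proof.
move=> Ap; rewrite corruptedE Ap => [|B H G]; last exact: huber_law_swap.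
rewrite (sum_truncated_subset _ _ (fun B => huber_law eps p M B K)).
rewrite -(mixture_huber_law K cM) mulr_suml [X in _ + X]big_mkcond -big_split /=.
apply: ler_sum => B _; rewrite /truncate_set; case: ifP => _ /=.
  by rewrite addr0.
by rewrite lerDr mulr_ge0 ?huber_law_ge0 ?bern_ge0 ?(lt0W_le1 (cont_eps cM)).
Qed.

(** The maximum dominates the [p]-weight, and [1 / S v >= 1 / (1 + eps) >= 1 - eps]. *)
Lemma max_contaminates (R : realType) n (eps p q : R) (S : 'I_n -> R) :
  0 < eps <= 1 -> 0 <= p <= 1 ->
  (forall v, \sum_(K : graph n | K \subset owned v)
     Num.max (bern p (owned v) K) (bern q (owned v) K) = S v) ->
  (forall v, S v <= 1 + eps) ->
  contaminates eps p (fun v K =>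
    Num.max (bern p (owned v) K) (bern q (owned v) K) / S v).
Proof.
move=> heps hp SE Sle; have /andP[e0 e1] := heps.
have S1 v : 1 <= S v.
  rewrite -(sum_bern p (owned v)) -SE; apply: ler_sum => K _.
  by rewrite le_max lexx.
have S0 v : 0 < S v by apply: lt_le_trans (S1 v).
split=> // [v K | v | v K]; first by rewrite !bern_determined.
  by rewrite -mulr_suml SE divff // gt_eqF.
rewrite ler_pdivlMr //; apply: (@le_trans _ _ (bern p (owned v) K)); last first.
  by rewrite le_max lexx.
have := bern_ge0 (owned v) K hp; have := Sle v; have := S1 v.
rewrite mulrAC => h1 h2 h3; rewrite ler_piMl //.
by nra.
Qed.

(** * The two adversaries and the three regimes of the gap *)

Lemma huber_adversary (R : realType) n (gamma p q : R) :
  (1 <= n)%N -> 0 < gamma < 1 / 2 -> p != q ->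
  forall (hp : 0 <= p <= 1) (hq : 0 <= q <= 1),
  (forall v : 'I_n, \sum_(K : graph n | K \subset owned v)
     Num.max (bern p (owned v) K) (bern q (owned v) K) <= 1 + gamma / 10) ->
  exists A : oblivious_adversary n gamma, forall T : algorithm R n,
    success_prob T (corrupted A hp) (corrupted A hq) <= 65 / 100.
Proof.
move=> n1 /andP[g0 g1] pq hp hq Sle; pose eps := gamma / 10.
have heps : 0 < eps <= 1 by rewrite /eps; apply/andP; split; lra.
pose S v := \sum_(K : graph n | K \subset owned v)
     Num.max (bern p (owned v) K) (bern q (owned v) K).
pose M v (K : graph n) :=
  Num.max (bern p (owned v) K) (bern q (owned v) K) / S v.
have cp : contaminates eps p M by apply: max_contaminates.
have cq : contaminates eps q M.
  (* The maximum and its normalizer are symmetric in [p] and [q], so both models are steered to the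
     same target [M]. *)
  have [???? h] : contaminates eps q (fun v K =>
      Num.max (bern q (owned v) K) (bern p (owned v) K) / S v).
    apply: max_contaminates => // v; apply: eq_bigr => K _; exact: maxC.
  split=> // [v K | v | v K].
  - by rewrite /M !bern_determined.
  - exact: (cont_sum1 cp).
  - by rewrite /M maxC; exact: h.
pose A (r : R) := if r == p then huber_strategy (ltW g0) cp
                  else huber_strategy (ltW g0) cq.
exists A => T; set ov := overflow n eps (gamma * n%:R).
have ov0 : 0 <= ov.
  by apply: sumr_ge0 => B _; apply/bern_ge0/lt0W_le1.
have n0 : 0 < n%:R :> R by rewrite ltr0n.
have ov1 : ov <= 1 / 10.
  have := random_subset_markov 'I_n (gamma * n%:R) (lt0W_le1 heps).
  rewrite -/(overflow n eps (gamma * n%:R)) -/ov card_ord /eps.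
  have -> : n%:R * (gamma / 10) = gamma * n%:R * (1 / 10) by ring.
  by rewrite ler_pM2l // mulr_gt0.
apply: le_trans (@success_prob_le _ _ T _ _ (fun K => \prod_v M v K)
  (fun K => ov * huber_law eps p M set0 K)
  (fun K => ov * huber_law eps q M set0 K) _ _ _ _) _.
- move=> K; apply: (corrupted_huber_le (g0 := ltW g0) (cM := cp)).
  by rewrite /A eqxx.
- move=> K; apply: (corrupted_huber_le (g0 := ltW g0) (cM := cq)).
  by rewrite /A eq_sym (negbTE pq).
- by move=> K; rewrite mulr_ge0 ?huber_law_ge0.
- by move=> K; rewrite mulr_ge0 ?huber_law_ge0.
rewrite -!mulr_sumr !huber_law_sum1 //.
rewrite (sum_prod_owned (cont_det cp) (cont_sum1 cp)).
(* The success probability is at most [(1 + 1/10 + 1/10) / 2 = 0.6]. *)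
by rewrite !mulr1 ler_pdivrMr //; lra.
Qed.

(** The best test succeeds with half the sum of the maxima, and [13/10] is twice [0.65]. *)
Lemma idle_adversary (R : realType) n (gamma p q : R) :
  0 <= gamma -> forall (hp : 0 <= p <= 1) (hq : 0 <= q <= 1),
  \sum_(K : graph n) Num.max (gnp_pmf p K) (gnp_pmf q K) <= 13 / 10 ->
  exists A : oblivious_adversary n gamma, forall T : algorithm R n,
    success_prob T (corrupted A hp) (corrupted A hq) <= 65 / 100.
Proof.
move=> g0 hp hq Sle.
pose A (r : R) := if r == p then idle_strategy n g0 hp
                  else idle_strategy n g0 hq.
exists A => T.
apply: le_trans (@success_prob_le _ _ T _ _
  (fun K => Num.max (gnp_pmf p K) (gnp_pmf q K))
  (fun=> 0) (fun=> 0) _ _ _ _) _ => //.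
- by move=> K; rewrite addr0 (corrupted_idle (g0 := g0)) /A ?eqxx // le_max lexx.
- case: (eqVneq p q) => [pq | pq] K; last first.
    rewrite addr0 (corrupted_idle (g0 := g0)) /A.
      by rewrite le_max lexx orbT.
    by rewrite eq_sym (negbTE pq).
  subst q; rewrite (bool_irrelevance hq hp).
  by rewrite addr0 (corrupted_idle (g0 := g0)) /A ?eqxx // le_max lexx.
by rewrite !big1_eq !addr0 ler_pdivrMr //; lra.
Qed.

Lemma sum_max_gnp_refl (R : realType) n (p : R) :
  \sum_(K : graph n) Num.max (gnp_pmf p K) (gnp_pmf p K) = 1.
Proof. by under eq_bigr do rewrite maxxx; rewrite gnp_pmf_sum1. Qed.

(** The chi-square bound with [a = c]: the divergence is at most [c^2], for a total of
    [1 + c + c/2]. It serves with [N = n] for the whole graph and [N = sqrt n] for the edges of one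
    owner. *)
Lemma sum_max_bern_scaled (R : realType) (E : finType) (A : {set E})
    (N c p q : R) :
  0 < p < 1 -> 0 < c <= 1 / 20 -> 0 < N -> #|A|%:R <= N ^+ 2 ->
  `|q - p| <= c * Num.sqrt (p * (1 - p)) / N ->
  \sum_(K : {set E} | K \subset A) Num.max (bern p A K) (bern q A K) <=
  1 + 2 * c.
Proof.
move=> hp /andP[c0 c1] N0 AN hqp; have /andP[p0 p1] := hp.
have v0 : 0 < p * (1 - p) by rewrite mulr_gt0 // subr_gt0.
have hx : #|A|%:R * ((q - p) ^+ 2 / (p * (1 - p))) <= c ^+ 2.
  have dx : (q - p) ^+ 2 / (p * (1 - p)) <= c ^+ 2 / N ^+ 2.
    rewrite ler_pdivrMr // -real_normK ?num_real //.
    apply: le_trans (_ : (c * Num.sqrt (p * (1 - p)) / N) ^+ 2 <= _).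
      by rewrite ler_sqr ?nnegrE // (le_trans _ hqp).
    rewrite !exprMn (sqr_sqrtr (ltW v0)) exprVn.
    by rewrite mulrAC.
  have N2 : 0 < N ^+ 2 by rewrite exprn_gt0.
  apply: le_trans (_ : N ^+ 2 * (c ^+ 2 / N ^+ 2) <= _).
    by apply: ler_pM => //; rewrite ?ler0n ?divr_ge0 ?sqr_ge0 ?(ltW v0).
  by rewrite mulrC divfK // gt_eqF.
apply: le_trans (@sum_max_bern_chi2 _ _ A p q c hp c0 _) _.
  by apply: le_trans hx _; nra.
have : #|A|%:R * ((q - p) ^+ 2 / (p * (1 - p))) / (2 * c) <= c / 2.
  rewrite ler_pdivrMr ?mulr_gt0 //; apply: le_trans hx _.
  by rewrite expr2; nra.
by lra.
Qed.

Theorem theorem1p5 (R : realType) :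
  exists C' : R, 0 < C' /\
    forall (gamma p : R) (n : nat),
      0 <= gamma -> gamma < 1 / 2 -> (1 <= n)%N ->
    forall (p' : R) (hp : 0 <= p <= 1) (hp' : 0 <= p' <= 1),
      p - Delta C' n gamma p <= p' <= p + Delta C' n gamma p ->
    exists A : oblivious_adversary n gamma,
      forall T : algorithm R n,
        success_prob T (corrupted A hp) (corrupted A hp') <= 65 / 100.
Proof.
(* The gap is at most three times the largest of the three terms of [Delta], hence the factor
   [1/20 = 3/60] below. *)
exists (1 / 60); split; first by lra.
move=> gamma p n g0 g1 n1 p' hp hp' hD.
have [pp' | pp'] := eqVneq p p'.
  by apply: idle_adversary => //; rewrite -pp' sum_max_gnp_refl; lra.
have d0 : 0 < `|p' - p| by rewrite normr_gt0 subr_eq0 eq_sym.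
have n0 : 0 < n%:R :> R by rewrite ltr0n.
set s := Num.sqrt (p * (1 - p)).
have s_interior : s != 0 -> 0 < p < 1.
  move: hp => /andP[p0 p1]; rewrite /s !lt_neqAle p0 p1 !andbT.
  apply: contraNT; rewrite negb_and !negbK => /orP[/eqP <- | /eqP ->].
    by rewrite mul0r sqrtr0.
  by rewrite subrr mulr0 sqrtr0.
have dD : `|p' - p| <= Delta (1 / 60) n gamma p.
  by rewrite ler_norml; case/andP: hD => *; apply/andP; split; lra.
have [d1 | [d2 | d3]] : `|p' - p| <= 1 / 20 * (s / n%:R) \/
    (`|p' - p| <= 1 / 20 * (gamma * s / Num.sqrt n%:R) \/
     `|p' - p| <= 1 / 20 * (gamma / n%:R)).
- move: dD; rewrite /Delta -/s.
  set x := s / _; set y := gamma * s / _; set z := gamma / _ => dD.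
  have [|h1] := leP `|p' - p| (1 / 20 * x); first by left.
  have [|h2] := leP `|p' - p| (1 / 20 * y); first by right; left.
  by right; right; lra.
- rewrite mulrA in d1.
  (* If [s] vanished, this bound would force [p' = p], which is excluded; the same argument gives
     [0 < gamma] in the other regimes. *)
  have s0 : s != 0 by apply: contraTneq d1 => ->; rewrite mulr0 mul0r -ltNge.
  apply: idle_adversary => //; under eq_bigr do rewrite !gnp_pmf_bernT.
  have -> : \sum_(K : graph n) Num.max (bern p setT K) (bern p' setT K) =
      \sum_(K : graph n | K \subset setT)
        Num.max (bern p setT K) (bern p' setT K).
    by apply: eq_bigl => K; rewrite subsetT.
  apply: le_trans
    (@sum_max_bern_scaled _ _ _ n%:R (1 / 20) p p' _ _ _ _ _) _ => //.
  + exact: s_interior.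
  + by apply/andP; split; lra.
  + by rewrite -natrX ler_nat -mulnn card_edges.
  by lra.
- rewrite !mulrA in d2.
  have s0 : s != 0 by apply: contraTneq d2 => ->; rewrite mulr0 mul0r -ltNge.
  have gp : 0 < gamma.
    rewrite lt_neqAle g0 andbT eq_sym; apply: contraTneq d2 => ->.
    by rewrite mulr0 !mul0r -ltNge.
  apply: huber_adversary => //; first by rewrite gp.
  move=> v; apply: le_trans (@sum_max_bern_scaled _ _ _ (Num.sqrt n%:R)
    (1 / 20 * gamma) p p' _ _ _ _ _) _ => //.
  + exact: s_interior.
  + by apply/andP; split; lra.
  + by rewrite sqrtr_gt0.
  + by rewrite sqr_sqrtr ?ler0n // ler_nat card_owned.
  by lra.
rewrite mulrA in d3; have gp : 0 < gamma.
  rewrite lt_neqAle g0 andbT eq_sym; apply: contraTneq d3 => ->.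
  by rewrite mulr0 !mul0r -ltNge.
apply: huber_adversary => //; first by rewrite gp.
move=> v; apply: le_trans (sum_max_bern_union _ hp hp') _; rewrite lerD2l.
(* The union bound over at most [n] owned edges totals [gamma / 20], within the allowed
   [gamma / 10]. *)
apply: le_trans (_ : n%:R * (1 / 20 * gamma / n%:R) <= _).
  by apply: ler_pM; rewrite ?ler0n ?normr_ge0 ?ler_nat ?card_owned.
rewrite mulrC divfK ?gt_eqF //; lra.
Qed.
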